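(* Let $m,n\ge0$ be integers. The map $\zeta$ described in the context is a bijection $$\zeta:\mathsf{LPP}(m+1,n+1)\to\mathsf{RTT}(m,1,n),$$ where $\mathsf{RTT}(m,1,n)$ here denotes the set of tiered trees with $m$ vertices in tier $1$, one vertex in tier $2$ and $n$ vertices in tier $3$ (and no others), rooted at the unique vertex in tier $2$.
   Context: **Polyominoes.** A parallelogram polyomino of size $a\times b$ is a pair of lattice paths from $(0,0)$ to $(a,b)$ with unit north and east steps, such that the first (red) path lies strictly above the second (green) path except at the two endpoints. A labelled parallelogram polyomino is one in which a positive integer is placed in each unit square that has a vertical red step as its left edge and/or a horizontal green step as its bottom edge, so that the labels in each column are strictly increasing from bottom to top and the labels in each row are strictly decreasing from left to right. $\mathsf{LPP}(a,b)$ is the set of labelled parallelogram polyominoes of size $a\times b$. The label of the bottom-left square (the only square with both a vertical red step and a horizontal green step) is the black label; the other labels are red or green according to the colour of the path step in their square. **Trees.** A tiered tree is a finite tree $T=(V,E)$ with a level (tier) function $\mathsf{lv}:V\to\mathbb{N}$ and a labelling $w:V\to\{1,2,\dots\}$. Here $T$ is rooted at its unique vertex $r$ of tier $2$, and $p(i)$ denotes the parent of a vertex $i\neq r$. The conditions are: (1) $\{i,j\}\in E$ implies $\mathsf{lv}(i)\ne\mathsf{lv}(j)$; (2) $\{i,j\}\in E$ and $\mathsf{lv}(i)<\mathsf{lv}(j)$ imply $w(i)<w(j)$; (3) if $i\ne j$, $p(i)=p(j)$ and $\mathsf{lv}(i)=\mathsf{lv}(j)$, then $w(i)\ne w(j)$.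 Trees are considered up to isomorphism preserving root, tiers and labels. **The map $\zeta$.** For $P\in\mathsf{LPP}(m+1,n+1)$, the vertices of $\zeta(P)$ correspond one-to-one to the labelled squares of $P$, each vertex carrying the label of its square. The $m$ green labels are placed in tier $1$, the black label in tier $2$, and the $n$ red labels in tier $3$. Two vertices in distinct tiers are joined by an edge if and only if the corresponding labelled squares lie in the same row or the same column of $P$. The root is the vertex in tier $2$. *)

(* Defs.v *)
From mathcomp Require Import all_boot.

Set Implicit Arguments.
Unset Strict Implicit.
Unset Printing Implicit Defensive.

(* Lattice paths starting at (0,0), as words in the unit steps. *)

Definition north : bool := true.
Definition east : bool := false.

Definition position (p : seq bool) (k : nat) : nat * nat :=
  (count_mem east (take k p), count_mem north (take k p)).

Definition path_points (p : seq bool) : seq (nat * nat) :=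
  [seq position p k | k <- iota 0 (size p).+1].

Definition step_starts (d : bool) (p : seq bool) : seq (nat * nat) :=
  [seq position p k | k <- iota 0 (size p) & nth east p k == d].

Definition path_to (a b : nat) (p : seq bool) : bool :=
  position p (size p) == (a, b).

(* On each vertical line, every lattice point of [p] is above every lattice
   point of [q]; the paths meet only at (0,0) and (a,b). *)
Definition strictly_above (a b : nat) (p q : seq bool) : bool :=
  all (fun u => all (fun v =>
    (u.1 == v.1) ==>
      ((v.2 < u.2) || ((u == v) && (u \in [:: (0, 0); (a, b)]))))
    (path_points q)) (path_points p).

Record parallelogram_polyomino (a b : nat) := ParallelogramPolyomino {
  red : seq bool;
  green : seq bool;
  red_path : path_to a b red;
  green_path : path_to a b green;
  red_above_green : strictly_above a b red green
}.

(* The unit square with bottom-left corner (i,j) is the pair (i,j): column i,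
   row j, counted from 0 from the left and from the bottom. All the squares
   which may carry a label lie in the a x b bounding box. *)
Notation square a b := ('I_a * 'I_b)%type.

Definition corner (a b : nat) (s : square a b) : nat * nat :=
  (val s.1, val s.2).

Definition has_red (a b : nat) (P : parallelogram_polyomino a b)
  (s : square a b) : bool := corner s \in step_starts north (red P).

Definition has_green (a b : nat) (P : parallelogram_polyomino a b)
  (s : square a b) : bool := corner s \in step_starts east (green P).

Definition labelled (a b : nat) (P : parallelogram_polyomino a b)
  (s : square a b) : bool := has_red P s || has_green P s.

(* The value 0 means that the square is empty. *)
Record LPP (a b : nat) := LabelledPP {
  pp :> parallelogram_polyomino a b;
  label : {ffun square a b -> nat};
  label_support : [forall s, (0 < label s) == labelled pp s];
  label_columns : [forall s, forall t,
    [&& labelled pp s, labelled pp t, s.1 == t.1 & s.2 < t.2]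
      ==> (label s < label t)];
  label_rows : [forall s, forall t,
    [&& labelled pp s, labelled pp t, s.2 == t.2 & s.1 < t.1]
      ==> (label t < label s)]
}.

Record tiered_graph := TieredGraph {
  vertex : finType;
  edge : rel vertex;
  lv : vertex -> nat;
  wt : vertex -> nat
}.

Definition is_tree (T : tiered_graph) : Prop :=
  [/\ 0 < #|vertex T|,
      symmetric (@edge T),
      irreflexive (@edge T),
      forall x y : vertex T, connect (@edge T) x y
    & forall c : seq (vertex T), uniq c -> cycle (@edge T) c -> size c <= 2].

(* [p] is the vertex following [i] on a simple path from [i] to the root. *)
Definition is_parent (T : tiered_graph) (r i p : vertex T) : Prop :=
  exists c : seq (vertex T),
    [/\ path (@edge T) i (p :: c), uniq (i :: p :: c) & last p c = r].

Definition tiered_tree (T : tiered_graph) (r : vertex T) : Prop :=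
  [/\ is_tree T,
      forall i : vertex T, 0 < wt i,
      forall i j : vertex T, edge i j -> lv i <> lv j,
      forall i j : vertex T, edge i j -> lv i < lv j -> wt i < wt j
    & forall i j p : vertex T, i <> j -> is_parent r i p -> is_parent r j p ->
        lv i = lv j -> wt i <> wt j].

Definition tier (T : tiered_graph) (l : nat) : {set vertex T} :=
  [set x | lv x == l].

(* RTT(m,1,n); its elements are taken up to [tt_iso]. *)
Definition RTT (m n : nat) (T : tiered_graph) : Prop :=
  [/\ #|tier T 1| = m, #|tier T 2| = 1, #|tier T 3| = n,
      forall x : vertex T, lv x \in [:: 1; 2; 3]
    & exists2 r : vertex T, r \in tier T 2 & tiered_tree r].

(* Between elements of RTT(m,1,n) such a map also preserves the root, which is
   the only vertex of tier 2. *)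
Definition tt_iso (T T' : tiered_graph) : Prop :=
  exists f : vertex T -> vertex T',
    [/\ bijective f,
        forall x y, edge (f x) (f y) = edge x y,
        forall x, lv (f x) = lv x
      & forall x, wt (f x) = wt x].

Definition square_tier (a b : nat) (P : LPP a b) (s : square a b) : nat :=
  if corner s == (0, 0) then 2 else if has_green P s then 1 else 3.

Definition zeta (a b : nat) (P : LPP a b) : tiered_graph :=
  @TieredGraph {s : square a b | labelled P s}
    (fun x y => (square_tier P (val x) != square_tier P (val y))
       && (((val x).1 == (val y).1) || ((val x).2 == (val y).2)))
    (fun x => square_tier P (val x))
    (fun x => label P (val x)).

(* Main.v *)
Require Import Defs.
From mathcomp Require Import all_boot.

Set Implicit Arguments.
Unset Strict Implicit.
Unset Printing Implicit Defensive.

(** Every row [j] of a parallelogram polyomino contains exactly one square whose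
    left edge is a red step, in some column [x j], and every column [i] contains
    exactly one square whose bottom edge is a green step, in some row [y i]. The
    polyomino amounts to the pair [(x, y)]: both are weakly increasing and vanish
    at 0, and the two paths do not touch exactly when [x (y i) < i] for [i > 0]
    (equivalently [y (x j) < j] for [j > 0]); this is [interlaced], with
    [polyomino_interlaced] and [interlaced_polyomino] for the two directions.

    Zeta joins the red square of row [j] to the green square of its column
    [x j], and the green square of column [i] to the red square of its row
    [y i]; the black square counts as the red square of row 0 and as the green
    square of column 0. These neighbours are parents, because passing to them
    decreases the sum of the two coordinates. A graph whose edges join each
    vertex to such a parent is a tree ([parent_function_tree]) in which the
    parents are the ones given by simple paths to the root ([is_parentP]); the
    label conditions on rows and columns then give those of a tiered tree
    ([zeta_RTT]).

    Injectivity. An isomorphism commutes with parents, hence induces a map of the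
    rows and a map of the columns. Two red squares are ordered as their columns
    are, and by increasing label within a column; two green squares are
    ordered as their rows are, and by decreasing label within a row. By
    induction along parents both induced maps are increasing ([shift_mono]), so
    they are identities, and the two labelled polyominoes coincide.

    Surjectivity. The same rule tells in which order the vertices of a given tree
    must be placed: read breadth first, siblings being ordered by increasing
    label in tier 3 and by decreasing label in tier 1. [breadth_first_key]
    realises this order by a numerical key, the digits of which, in a large
    base, are read on the path from the root to the vertex. Sorting tiers 2
    and 3, and tiers 2 and 1, by this key numbers the rows and the columns; the
    positions of the parents are then an interlaced pair ([bfs_coordinates]), and the resulting
    labelled polyomino is mapped to the given tree ([exists_zeta_iso]). *)

(** * Lattice paths *)

(** The number of steps in the direction opposite to [d] that precede the
    [j]-th step in direction [d], counted from 0: the column of the [j]-th north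
    step, or the row of the [j]-th east step. *)
Fixpoint offset (d : bool) (p : seq bool) (j : nat) : nat :=
  if p is c :: p' then
    if c == d then (if j is j'.+1 then offset d p' j' else 0)
    else (offset d p' j).+1
  else 0.

Lemma offset_ex d p j : j < count_mem d p ->
  exists k, [/\ k < size p, nth east p k = d, count_mem d (take k p) = j
              & count_mem (~~ d) (take k p) = offset d p j].
Proof.
case: d; elim: p j => [|[] p IHp] // [|j];
  rewrite /= ?add1n ?add0n ?ltnS //;
  try (by move=> _; exists 0); by move=> /IHp[k [kp pk <- <-]]; exists k.+1.
Qed.

Lemma offset_at d p k : k < size p -> nth east p k = d ->
  offset d p (count_mem d (take k p)) = count_mem (~~ d) (take k p).
Proof.
case: d; elim: p k => [|[] p IHp] // [|k] //=; rewrite ltnS ?add1n ?add0n => kp pk;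
  by rewrite /= IHp.
Qed.

Lemma offset_before d p k j :
  j < count_mem d (take k p) -> offset d p j <= count_mem (~~ d) (take k p).
Proof.
case: d; elim: p k j => [|[] p IHp] // [|k] [|j] //=;
  by rewrite ?add1n ?add0n ?ltnS //; exact: IHp.
Qed.

Lemma offset_after d p k j : count_mem d (take k p) <= j ->
  j < count_mem d p -> count_mem (~~ d) (take k p) <= offset d p j.
Proof.
case: d; elim: p k j => [|[] p IHp] // [|k] [|j] //=;
  by rewrite ?add1n ?add0n ?ltnS //; exact: IHp.
Qed.

Lemma leq_offset d p j j' : j <= j' -> j' < count_mem d p ->
  offset d p j <= offset d p j'.
Proof.
rewrite leq_eqVlt => /predU1P[-> // | lt_j] /offset_ex[k [_ _ def_j' <-]].
by apply: offset_before; rewrite def_j'.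
Qed.

Lemma offset_le d p j : offset d p j <= count_mem (~~ d) p.
Proof. by case: d; elim: p j => [|[] p IHp] // [|j] //=; exact: IHp. Qed.

(** The offsets, together with the number of steps in each direction, determine
    the path. *)
Lemma offset_inj d p q :
    count_mem d p = count_mem d q -> count_mem (~~ d) p = count_mem (~~ d) q ->
    (forall j, j < count_mem d p -> offset d p j = offset d q j) ->
  p = q.
Proof.
case: d; elim: p q => [|[] p IHp] [|[] q] //=; rewrite ?add1n ?add0n //;
  try (by move=> *; congruence);
  try (by move=> ed eo /(_ 0 isT)); try (by move=> -> _ /(_ 0 isT)).
- by move=> [ed] eo eoff; rewrite (IHp q) // => j lt_j; exact: (eoff j.+1).
- by move=> ed [eo] eoff; rewrite (IHp q) // => j /eoff[].
- by move=> ed [eo] eoff; rewrite (IHp q) // => j /eoff[].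
- by move=> [ed] eo eoff; rewrite (IHp q) // => j lt_j; exact: (eoff j.+1).
Qed.

Lemma offset_nseq d k p j : offset d (nseq k (~~ d) ++ p) j = k + offset d p j.
Proof. by elim: k => //= k ->; case: (d). Qed.

(** Conversely every weakly increasing sequence of bounded offsets comes from a
    path. *)
Lemma offset_onto d a (s : seq nat) : sorted leq s -> all (leq^~ a) s ->
  exists p, [/\ count_mem d p = size s, count_mem (~~ d) p = a
              & forall j, j < size s -> offset d p j = nth 0 s j].
Proof.
(* [c] is the number of steps opposite to [d] already made. *)
suff gen c: c <= a -> path leq c s -> all (leq^~ a) s ->
  exists p, [/\ count_mem d p = size s, count_mem (~~ d) p = a - c
              & forall j, j < size s -> c + offset d p j = nth 0 s j].
  move=> s_sorted s_le; case: (gen 0) => // [|p]; last by rewrite subn0; exists p.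
  by case: (s) s_sorted.
elim: s c => [|h s IHs] c ca /=.
  exists (nseq (a - c) (~~ d)).
  by rewrite !count_nseq /= eqxx mul1n; split=> //; case: (d).
case/andP=> ch hs /andP[ha sa]; have [p [pd po off]] := IHs h ha hs sa.
exists (nseq (h - c) (~~ d) ++ d :: p); split=> [||j].
- by rewrite count_cat count_nseq /= eqxx pd add1n; case: (d).
- rewrite count_cat count_nseq /= eqxx po mul1n.
  by rewrite (_ : (d == ~~ d) = false) ?add0n; [rewrite addnC addnBA // subnK | case: (d)].
rewrite offset_nseq addnA subnKC //= eqxx.
by case: j => [|j /off]; rewrite ?addn0.
Qed.
Lemma path_pointsP p u :
  reflect (exists2 k, k <= size p & u = position p k) (u \in path_points p).
Proof.
apply: (iffP mapP) => [[k]|[k kp ->]]; first by rewrite mem_iota; exists k.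
by exists k; rewrite // mem_iota.
Qed.

Lemma step_startsP d p u :
  reflect (exists k, [/\ k < size p, nth east p k = d & u = position p k])
    (u \in step_starts d p).
Proof.
apply: (iffP mapP) => [[k]|[k [kp pk ->]]].
  by rewrite mem_filter mem_iota => /andP[/eqP pk kp]; exists k.
by exists k; rewrite // mem_filter mem_iota pk eqxx.
Qed.

Lemma mem_norths p i j : ((i, j) \in step_starts north p) =
  (j < count_mem north p) && (i == offset north p j).
Proof.
apply/step_startsP/andP => [[k [kp pk [-> ->]]]|[/offset_ex[k [kp pk jk ik]] /eqP->]].
  rewrite (offset_at kp pk) eqxx -{2}(cat_take_drop k p) count_cat (drop_nth east kp).
  by rewrite pk /= addnA addn1 leq_addr.
by exists k; split=> //; rewrite -ik -jk.
Qed.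

Lemma mem_easts p i j : ((i, j) \in step_starts east p) =
  (i < count_mem east p) && (j == offset east p i).
Proof.
apply/step_startsP/andP => [[k [kp pk [-> ->]]]|[/offset_ex[k [kp pk jk ik]] /eqP->]].
  rewrite (offset_at kp pk) eqxx -{2}(cat_take_drop k p) count_cat (drop_nth east kp).
  by rewrite pk /= addnA addn1 leq_addr.
by exists k; split=> //; rewrite -ik -jk.
Qed.

Lemma path_toE a b p :
  path_to a b p = (count_mem east p == a) && (count_mem north p == b).
Proof. by rewrite /path_to /position take_size xpair_eqE. Qed.

(** The lowest lattice point of a path on a given vertical line: the north steps
    below it start further left. *)
Lemma ex_point_col a b p i : path_to a b p -> i <= a ->
  exists h, (i, h) \in path_points p /\
    forall j, j < h -> offset north p j < i.
Proof.
rewrite path_toE => /andP[/eqP pa _]; case: i => [_|i lt_i].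
  by exists 0; split=> //; apply/path_pointsP; exists 0; rewrite ?/position ?take0.
have [k [kp pk ik _]] := @offset_ex east p i (etrans (congr1 _ pa) lt_i).
exists (count_mem north (take k p)); split=> [|j /(@offset_before north)].
  apply/path_pointsP; exists k.+1; rewrite // /position (take_nth east kp) pk.
  by rewrite -cats1 !count_cat ik addn0 addn1.
by rewrite ik ltnS.
Qed.
Lemma step_starts_points d p : {subset step_starts d p <= path_points p}.
Proof.
move=> u /step_startsP[k [kp _ ->]].
by apply/path_pointsP; exists k; rewrite // ltnW.
Qed.

Lemma path_end a b p : path_to a b p -> (a, b) \in path_points p.
Proof. by move/eqP <-; apply/path_pointsP; exists (size p). Qed.

(** * Polyominoes as interlaced pairs *)

(** [x j] stands for the column of the red square of row [j], and [y i] for the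
    row of the green square of column [i]. The last condition says that on the
    line between columns [i.-1] and [i] the green path stays below the red one:
    the red path has already risen above height [y i] when it reaches this line. *)
Record interlaced (m n : nat) (x y : nat -> nat) : Prop := Interlaced {
  col0 : x 0 = 0;
  row0 : y 0 = 0;
  col_le : forall j, j <= n -> x j <= m;
  row_le : forall i, i <= m -> y i <= n;
  col_mono : forall j j', j <= j' -> j' <= n -> x j <= x j';
  row_mono : forall i i', i <= i' -> i' <= m -> y i <= y i';
  col_row_lt : forall i, 0 < i -> i <= m -> x (y i) < i
}.

(** The reflection in the diagonal of [col_row_lt]: if [j <= y (x j)] then, [x]
    being increasing, [x j <= x (y (x j))], against [col_row_lt] at [x j]. *)
Lemma row_col_lt m n x y : interlaced m n x y ->
  forall j, 0 < j -> j <= n -> y (x j) < j.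
Proof.
move=> xy j j_gt0 jn; have xm := col_le xy jn.
case: (posnP (x j)) => [->|xj_gt0]; first by rewrite (row0 xy).
rewrite ltnNge; apply: contraL (col_row_lt xy xj_gt0 xm) => le_j.
by rewrite -leqNgt (col_mono xy le_j) // (row_le xy).
Qed.

Section Polyomino.

Variables m n : nat.
Implicit Type P : parallelogram_polyomino m.+1 n.+1.

Definition red_col P := offset north (red P).
Definition green_row P := offset east (green P).

Lemma count_red P :
  count_mem east (red P) = m.+1 /\ count_mem north (red P) = n.+1.
Proof. by have := red_path P; rewrite path_toE => /andP[/eqP-> /eqP->]. Qed.

Lemma count_green P :
  count_mem east (green P) = m.+1 /\ count_mem north (green P) = n.+1.
Proof. by have := green_path P; rewrite path_toE => /andP[/eqP-> /eqP->]. Qed.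

Lemma red_point P j : j <= n -> (red_col P j, j) \in path_points (red P).
Proof.
move=> jn; apply: (@step_starts_points north); rewrite mem_norths eqxx andbT.
by rewrite (count_red P).2.
Qed.

Lemma green_point P i : i <= m -> (i, green_row P i) \in path_points (green P).
Proof.
move=> im; apply: (@step_starts_points east); rewrite mem_easts eqxx andbT.
by rewrite (count_green P).1.
Qed.

Lemma red_above P i h h' :
    (i, h) \in path_points (red P) -> (i, h') \in path_points (green P) ->
  h' < h \/ h = h' /\ ((i, h) = (0, 0) \/ (i, h) = (m.+1, n.+1)).
Proof.
move=> ih ih'; have /allP/(_ _ ih)/allP/(_ _ ih') := red_above_green P.
rewrite eqxx /= !inE => /orP[|/andP[/eqP[->] /orP[]/eqP->]]; auto.
Qed.

Lemma polyomino_interlaced P : interlaced m n (red_col P) (green_row P).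
Proof.
have [rE rN] := count_red P; have [gE gN] := count_green P.
have xm j : j <= n -> red_col P j <= m.
  move=> jn; rewrite -ltnS ltn_neqAle -{2}rE offset_le andbT.
  apply: contraTN (jn) => /eqP xj; have := red_point P jn; rewrite xj.
  case/red_above/(_ (path_end (green_path P))) => [/ltnW|[-> _]].
    by rewrite -ltnNge.
  by rewrite ltnn.
have yn i : i <= m -> green_row P i <= n.
  move=> im; rewrite -ltnS ltn_neqAle -{2}gN offset_le andbT.
  apply/eqP=> yi; have := green_point P im; rewrite yi.
  have [h [ih _]] := ex_point_col (red_path P) (leqW im).
  case/(red_above ih) => [|[-> [|[ei]]]] //; last by rewrite ei ltnn in im.
  rewrite ltnNge; case/negP; case/path_pointsP: ih => k kp [_ ->].
  by rewrite -[leqRHS]rN leq_count_subseq ?take_subseq.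
split=> //.
- have := red_point P (leq0n n).
  have [h [ih _]] := ex_point_col (green_path P) (leqW (xm 0 isT)).
  by case/red_above/(_ ih) => // -[_ [[]|]].
- have := green_point P (leq0n m).
  have : (0, 0) \in path_points (red P).
    by apply/path_pointsP; exists 0; rewrite /position ?take0.
  by move=> o /(red_above o)[//|[<-]].
- by move=> j j' jj' jn; apply: leq_offset; rewrite ?rN.
- by move=> i i' ii' im; apply: leq_offset; rewrite ?gE.
move=> i i_gt0 im; rewrite ltnNge; apply/negP=> le_i.
have [h [ih xh]] := ex_point_col (red_path P) (leqW im).
have [lt_h|[_ [[i0]|[i1]]]] := red_above ih (green_point P im).
- by have := xh _ lt_h; rewrite ltnNge le_i.
- by rewrite i0 in i_gt0.
by rewrite i1 ltnn in im.
Qed.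

Lemma has_redE P s : has_red P s = (s.1 == red_col P s.2 :> nat).
Proof. by rewrite /has_red mem_norths (count_red P).2 ltn_ord. Qed.

Lemma has_greenE P s : has_green P s = (s.2 == green_row P s.1 :> nat).
Proof. by rewrite /has_green mem_easts (count_green P).1 ltn_ord. Qed.

Lemma polyomino_inj P Q :
    (forall j, j <= n -> red_col P j = red_col Q j) ->
    (forall i, i <= m -> green_row P i = green_row Q i) ->
  P = Q.
Proof.
have [rE rN] := count_red P; have [gE gN] := count_green P.
have [rE' rN'] := count_red Q; have [gE' gN'] := count_green Q.
move=> eq_x eq_y.
have: red P = red Q.
  by apply: (@offset_inj north); rewrite ?rN' ?rN ?rE' ?rE.
have: green P = green Q.
  by apply: (@offset_inj east); rewrite ?gN' ?gN ?gE' ?gE.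
clear eq_x eq_y rE rN gE gN rE' rN' gE' gN'.
case: P Q => [r g rP gP rg] [r1 g1 rP1 gP1 rg1] /= eg er.
by subst; congr ParallelogramPolyomino; exact: eq_irrelevance.
Qed.

Lemma interlaced_polyomino x y : interlaced m n x y -> exists P,
  (forall j, j <= n -> red_col P j = x j) /\
  (forall i, i <= m -> green_row P i = y i).
Proof.
move=> xy.
have sorted_mk k z : (forall j j', j <= j' -> j' <= k -> z j <= z j') ->
    sorted leq (mkseq z k.+1).
  move=> zP; apply/(sortedP 0) => i; rewrite size_mkseq => ik.
  by rewrite !nth_mkseq ?zP // ltnW.
have all_mk a k z : (forall j, j <= k -> z j <= a) ->
    all (leq^~ a.+1) (mkseq z k.+1).
  move=> zP; apply/allP=> _ /mapP[j jk ->]; rewrite mem_iota in jk.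
  by rewrite leqW ?zP.
have [r [rN rE xr]] := offset_onto north (sorted_mk _ _ (col_mono xy))
  (all_mk _ _ _ (col_le xy)).
have [g [gE gN yg]] := offset_onto east (sorted_mk _ _ (row_mono xy))
  (all_mk _ _ _ (row_le xy)).
rewrite size_mkseq in rN xr; rewrite size_mkseq in gE yg.
have {}xr j : j <= n -> offset north r j = x j by move=> jn; rewrite xr ?nth_mkseq.
have {}yg i : i <= m -> offset east g i = y i by move=> im; rewrite yg ?nth_mkseq.
have rP : path_to m.+1 n.+1 r by rewrite path_toE rN rE !eqxx.
have gP : path_to m.+1 n.+1 g by rewrite path_toE gN gE !eqxx.
suff rg : strictly_above m.+1 n.+1 r g by exists (ParallelogramPolyomino rP gP rg).
apply/allP=> _ /path_pointsP[k _ ->]; apply/allP=> _ /path_pointsP[l _ ->].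
apply/implyP; rewrite /position /= => /eqP eq_i.
(* Compare the heights [h] and [h'] of the two paths on the line of abscissa
   [i]: the green path is at most at height [y i], and [x (y i) < i] puts the
   red path strictly above [y i]. *)
have leE p q : count_mem p (take q r) <= count_mem p r.
  by rewrite leq_count_subseq ?take_subseq.
have leE' p q : count_mem p (take q g) <= count_mem p g.
  by rewrite leq_count_subseq ?take_subseq.
have := leE east k; have := leE north k; have := leE' north l.
have rB := @offset_before north r k; have rA := @offset_after north r k.
have gB := @offset_before east g l; have gA := @offset_after east g l.
move: rB rA gB gA; rewrite /= -/north -/east rN rE gN gE eq_i.
set i := count_mem east _; set h := count_mem north _; set h' := count_mem north _.
move=> rB rA gB gA h'n hn im; rewrite !inE !xpair_eqE eqxx /=.
have [i0|i_gt0] := posnP i.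
  have := gA 0; rewrite i0 yg // (row0 xy) => /(_ isT isT); rewrite leqn0 => /eqP->.
  by case: (posnP h) => // ->.
rewrite /=; move: im; rewrite leq_eqVlt => /predU1P[i1|].
  rewrite i1 eqxx /=; have [lt_h|] := ltnP h n.+1.
    by have:= rA h (leqnn _) lt_h; rewrite i1 xr // leqNgt ltnS (col_le xy).
  move=> le_h; have -> : h = n.+1 by apply/eqP; rewrite eqn_leq hn.
  by rewrite eqxx andbT eq_sym orbC -leq_eqVlt.
rewrite ltnS => im.
have := gA i (leqnn _) im; rewrite yg // => /leq_ltn_trans->//.
rewrite ltnNge; apply/negP=> le_h.
have := rA _ le_h; rewrite ltnS xr ?(row_le xy) // => /(_ isT).
by rewrite leqNgt (col_row_lt xy).
Qed.

End Polyomino.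
(** * Trees as parent functions *)

Definition parent_function (T : tiered_graph) (r : vertex T)
    (par : vertex T -> vertex T) (depth : vertex T -> nat) : Prop :=
  [/\ par r = r,
      forall v, v != r -> depth (par v) < depth v
    & forall u v, edge u v =
        (u != r) && (par u == v) || (v != r) && (par v == u)].

Section ParentFunction.

Variables (T : tiered_graph) (r : vertex T).
Variables (par : vertex T -> vertex T) (depth : vertex T -> nat).
Hypothesis parT : parent_function r par depth.

Lemma edge_par v : v != r -> edge v (par v).
Proof. by case: parT => _ _ -> ->; rewrite eqxx. Qed.

Lemma par_neq v : v != r -> par v != v.
Proof.
by case: parT => _ ltp _ /ltp; apply: contraTneq => ->; rewrite ltnn.
Qed.

Lemma par_ind (P : vertex T -> Prop) :
  P r -> (forall v, v != r -> P (par v) -> P v) -> forall v, P v.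
Proof.
move=> Pr Pp v; have [k] := ubnP (depth v).
elim: k v => // k IHk v lt_v; have [-> // | vr] := eqVneq v r.
by apply: Pp (vr) (IHk _ _); case: parT => _ /(_ v vr) /leq_trans-> //.
Qed.

Lemma edge_deeper u v : depth u <= depth v -> edge u v -> v != r /\ par v = u.
Proof.
case: parT => _ ltp -> le_uv /orP[/andP[/ltp + /eqP pu]|/andP[vr /eqP]] //.
by rewrite pu ltnNge le_uv.
Qed.

Lemma parent_function_sym : symmetric (@edge T).
Proof. by case: parT => _ _ eT u v; rewrite !eT orbC. Qed.

(** In a cycle, both neighbours of a deepest vertex are its parent, so they
    coincide and the cycle has at most two vertices. *)
Lemma parent_function_tree : is_tree T.
Proof.
have eS := parent_function_sym; have eC := sym_connect_sym eS.
have rC v : connect (@edge T) v r.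
  elim/par_ind: v => [|v vr]; [exact: connect0 | apply: connect_trans].
  exact/connect1/edge_par.
split=> //.
- by apply/card_gt0P; exists r.
- by move=> v; apply/negP=> /(edge_deeper (leqnn _))[/par_neq/eqP].
- by move=> u v; apply: connect_trans (rC u) _; rewrite eC.
move=> c; case: c => // v0 c0; set c := v0 :: c0 => c_uniq c_cycle.
have [v cv v_max] := @arg_maxnP _ v0 [in c] depth (mem_head _ _).
have [i c' def_c] := rot_to cv; rewrite -(size_rot i) def_c.
have {}c_cycle: cycle (@edge T) (v :: c') by rewrite -def_c rot_cycle.
have {}c_uniq: uniq (v :: c') by rewrite -def_c rot_uniq.
have up u : u \in c' -> edge u v -> u = par v.
  move=> c'u; have cu : u \in c by rewrite -(mem_rot i) def_c inE c'u orbT.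
  by case/(edge_deeper (v_max u cu)).
case: c' c_cycle c_uniq up {def_c} => [|w c'] // + + up; rewrite /cycle rcons_path.
case/andP=> /andP[vw _] wv /and3P[_ wc' _].
have def_w : w = par v by apply: up; rewrite ?mem_head // parent_function_sym.
case/lastP: c' => // c' w' in up wc' wv *.
have def_w' : w' = par v.
  by apply: up; rewrite ?inE ?mem_rcons ?mem_head ?orbT // -(last_rcons w c' w').
by rewrite def_w def_w' mem_rcons mem_head in wc'.
Qed.

(** A simple path that once goes from a parent to a child can only go on to
    further children, and so never reaches the root; hence a simple path to the
    root starts with the parent. *)
Lemma is_parentP i p : is_parent r i p <-> i != r /\ p = par i.
Proof.
case: (parT) => par_r lt_par eT; split=> [[c [/= /andP[ip pc] ipc cr]]|[ir ->]].
  have down q c' : q != r -> path (@edge T) q c' -> uniq (par q :: q :: c') ->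
      last q c' != r.
    elim: c' q => //= v c' IHc q qr /andP[qv vc'].
    rewrite !inE !negb_or => /and3P[/and3P[_ qpv _] /andP[qv' qc'] vc'u].
    have [vr pv] : v != r /\ par v = q.
      by move: qv; rewrite eT qr /= (negPf qpv) /= => /andP[? /eqP].
    by apply: IHc; rewrite // pv /= inE (negPf qv') /= qc'.
  move: ip; rewrite eT => /orP[/andP[ir /eqP] | /andP[pr /eqP def_i]] //.
  by have := down p c pr pc; rewrite def_i cr eqxx => /(_ ipc).
suff [c [rc uc cr lec]]: exists c, [/\ path (@edge T) (par i) c,
    uniq (par i :: c), last (par i) c = r
    & all (fun v => depth v < depth i) (par i :: c)].
  exists c; split=> //; first by rewrite /= edge_par.
  rewrite cons_uniq uc andbT; apply/negP=> ic.
  by have := allP lec i ic; rewrite ltnn.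
elim/par_ind: i ir => [|i ir IHi _]; first by rewrite eqxx.
have [pr|pr] := eqVneq (par i) r.
  by exists [::]; rewrite /= lt_par ?andbT.
have [c [rc uc cr lec]] := IHi pr; exists (par (par i) :: c).
have lt_pi := lt_par i ir; split=> //.
- by rewrite /= edge_par.
- rewrite cons_uniq uc andbT; apply/negP=> ic.
  by have := allP lec _ ic; rewrite ltnn.
rewrite -[all _ _]/(_ && all _ (_ :: c)) lt_pi; apply: sub_all lec => v /ltn_trans->//.
Qed.

End ParentFunction.

(** Recursion from the root along parents; [g] iterates with the depth as fuel. *)
Lemma par_rec (T : tiered_graph) (r : vertex T) par depth (X : Type) (a : X)
    (step : vertex T -> X -> X) : parent_function r par depth ->
  exists g, g r = a /\ forall v, v != r -> g v = step v (g (par v)).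
Proof.
case=> _ lt_par _.
pose g := fix g k v : X :=
  if k is k'.+1 then if v == r then a else step v (g k' (par v)) else a.
have gE k v : depth v <= k -> g k v = g (depth v) v.
  elim/ltn_ind: k v => k IHk v le_k.
  case: k le_k IHk => [|k]; first by rewrite leqn0 => /eqP->.
  have [->|vr] := eqVneq v r; first by case: (depth r) => /=; rewrite eqxx.
  have := lt_par v vr; case: (depth v) => // d lt_p le_k IHk /=.
  rewrite (negPf vr) (IHk k) ?(IHk d) // -ltnS; exact: leq_trans lt_p le_k.
exists (fun v => g (depth v) v); split=> [|v vr].
  by case: (depth r) => /=; rewrite ?eqxx.
have := lt_par v vr; case: {2 3}(depth v) (erefl (depth v)) => // d def_d lt_p.
by rewrite def_d /= (negPf vr) gE // -ltnS -def_d.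
Qed.

(** The parent is a neighbour closer to the root. An edge between [u] and [v] that
    does not join a vertex to its parent can be deleted without disconnecting the
    graph, and a simple path from [u] to [v] avoiding it closes up to a cycle of
    length at least three. *)
Lemma tree_parent_function (T : tiered_graph) (r : vertex T) :
  is_tree T -> exists par depth, parent_function r par depth.
Proof.
case=> _ eS eI eC acyc.
pose reaches v k := [exists t : k.-tuple (vertex T), path (@edge T) v t && (last v t == r)].
have reach v : exists k, reaches v k.
  have /connectP[p vp rp] := eC v r; exists (size p).
  by apply/existsP; exists (in_tuple p); rewrite /= vp rp eqxx.
pose depth v := ex_minn (reach v).
have ex_par v : exists w, (v != r) ==> edge v w && (depth w < depth v).
  have [->|vr] := eqVneq v r; first by exists r.
  rewrite {2}/depth; case: ex_minnP => k /existsP[[[|w p] sz_p]] /=.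
    by rewrite (negPf vr).
  case/andP=> /andP[vw wp] pr _; exists w; rewrite vw /= /depth.
  case: ex_minnP => l _ le_l; rewrite -(eqP sz_p) ltnS; apply: le_l.
  by apply/existsP; exists (in_tuple p); rewrite /= wp.
have /fin_all_exists[par0 par0P] := ex_par.
pose par v := if v == r then r else par0 v.
have parP v : v != r -> edge v (par v) && (depth (par v) < depth v).
  by move=> vr; rewrite /par (negPf vr); exact: implyP (par0P v) vr.
exists par, depth; split=> [|v /parP/andP[]//|u v]; first by rewrite /par eqxx.
apply/idP/orP=> [uv|[]/andP[/parP/andP[+ _] /eqP<-]//]; last by rewrite eS.
apply/orP; apply: contraTT isT => not_par.
(* The graph without the edge [uv]; parents still connect all its vertices
   to [r]. *)
pose e := [rel x y | edge x y && ((x, y) != (u, v)) && ((x, y) != (v, u))].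
have eC' : connect_sym e.
  apply: sym_connect_sym => x y /=; rewrite eS -!andbA !xpair_eqE.
  congr (_ && _); rewrite [RHS]andbC.
  by congr (~~ _ && ~~ _); exact: andbC.
have rC x : connect e x r.
  have [k] := ubnP (depth x); elim: k x => // k IHk x lt_x.
  have [-> | xr] := eqVneq x r; first exact: connect0.
  have /andP[xp lt_p] := parP x xr.
  apply: connect_trans (IHk _ (leq_trans lt_p lt_x)); apply: connect1.
  rewrite /= xp /=; apply: contraR not_par; rewrite negb_and !negbK.
  by case/orP=> /eqP[? <-]; subst x; rewrite xr eqxx ?orbT.
have /connectP[p0 up0 vp0]: connect e u v.
  by apply: connect_trans (rC u) _; rewrite eC'.
case/shortenP: up0 vp0 => p up p_uniq _ vp.
have := acyc (u :: p) p_uniq; rewrite /cycle rcons_path -vp (eS v) uv andbT.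
have -> : path (@edge T) u p by apply: sub_path up => x y /= /andP[/andP[]].
case: p up vp {p_uniq} => [_ vu|w [|w' p]] /=.
- by rewrite vu eI in uv.
- by move=> + vw; rewrite -vw eqxx andbF.
by move=> _ _ /(_ isT).
Qed.
(** * The graph zeta P *)

Section Zeta.

Variables m n : nat.
Variable P : LPP m.+1 n.+1.

Notation x := (red_col P).
Notation y := (green_row P).

Let xy : interlaced m n x y := polyomino_interlaced P.

Definition red_ord (j : 'I_n.+1) : 'I_m.+1 := inord (x j).
Definition green_ord (i : 'I_m.+1) : 'I_n.+1 := inord (y i).

Lemma val_red_ord j : red_ord j = x j :> nat.
Proof. by rewrite inordK // ltnS (col_le xy) // -ltnS. Qed.

Lemma val_green_ord i : green_ord i = y i :> nat.
Proof. by rewrite inordK // ltnS (row_le xy) // -ltnS. Qed.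

Lemma red_square_labelled j : labelled P (red_ord j, j).
Proof. by rewrite /labelled has_redE val_red_ord eqxx. Qed.

Lemma green_square_labelled i : labelled P (i, green_ord i).
Proof. by rewrite /labelled orbC has_greenE val_green_ord eqxx. Qed.

Definition red_vertex j : vertex (zeta P) :=
  Sub (red_ord j, j) (red_square_labelled j).
Definition green_vertex i : vertex (zeta P) :=
  Sub (i, green_ord i) (green_square_labelled i).

Definition zeta_root : vertex (zeta P) := red_vertex ord0.

(** From a red square down to the green square of its column, from a green
    square left to the red square of its row. *)
Definition zeta_parent (s : vertex (zeta P)) : vertex (zeta P) :=
  if has_red P (val s) then green_vertex (val s).1 else red_vertex (val s).2.

Definition zeta_depth (s : vertex (zeta P)) : nat :=
  (val s).1 + (val s).2.

Lemma red_ord0 : red_ord ord0 = ord0.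
Proof. by apply: val_inj; rewrite /= val_red_ord (col0 xy). Qed.

Lemma green_ord0 : green_ord ord0 = ord0.
Proof. by apply: val_inj; rewrite /= val_green_ord (row0 xy). Qed.

Lemma green_vertex0 : green_vertex ord0 = zeta_root.
Proof. by apply: val_inj; rewrite /= red_ord0 green_ord0. Qed.

Lemma red_vertex_eq j j' : (red_vertex j == red_vertex j') = (j == j').
Proof. by apply/eqP/eqP => [/(congr1 val)[]|->]. Qed.

Lemma green_vertex_eq i i' : (green_vertex i == green_vertex i') = (i == i').
Proof. by apply/eqP/eqP => [/(congr1 val)[]|->]. Qed.

(** The black square is the only one that is both red and green: elsewhere
    [y (x j) < j]. *)
Lemma green_red_vertex_eq i j :
  (green_vertex i == red_vertex j) = (i == ord0) && (j == ord0).
Proof.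
apply/eqP/andP => [/(congr1 val)[/= def_i def_j]|[/eqP-> /eqP->]]; last first.
  exact: green_vertex0.
have [j0|j_gt0] := posnP j.
  have -> : j = ord0 by apply: val_inj.
  by rewrite def_i; have -> : j = ord0 by [apply: val_inj]; rewrite red_ord0.
have := row_col_lt xy j_gt0 (leq_ord j).
by rewrite -val_red_ord -def_i -val_green_ord def_j ltnn.
Qed.

Lemma green_vertex_root i : (green_vertex i == zeta_root) = (i == ord0).
Proof. by rewrite -green_vertex0 green_vertex_eq. Qed.

(** The root is classified as a red vertex only. *)
Variant vertex_spec : vertex (zeta P) -> Type :=
  | RedVertex j : vertex_spec (red_vertex j)
  | GreenVertex i of i != ord0 : vertex_spec (green_vertex i).

Lemma vertexP s : vertex_spec s.
Proof.
case: (boolP (has_red P (val s))) => [rs|rNs].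
  suff -> : s = red_vertex (val s).2 by constructor.
  apply: val_inj; case: s rs => -[i j] /= _; rewrite has_redE /= => /eqP ij.
  by congr (_, _); apply: val_inj; rewrite /= val_red_ord.
have gs : has_green P (val s) by have := valP s; rewrite /labelled (negPf rNs).
have def_s : s = green_vertex (val s).1.
  apply: val_inj; case: s gs {rNs} => -[i j] /= _; rewrite has_greenE /= => /eqP ij.
  by congr (_, _); apply: val_inj; rewrite /= val_green_ord.
rewrite def_s; constructor; apply: contraNneq rNs => s0; rewrite def_s s0.
by rewrite green_vertex0 has_redE val_red_ord.
Qed.

Lemma zeta_parent_red j : zeta_parent (red_vertex j) = green_vertex (red_ord j).
Proof. by rewrite /zeta_parent has_redE /= val_red_ord eqxx. Qed.

Lemma zeta_parent_green i :
  zeta_parent (green_vertex i) = red_vertex (green_ord i).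
Proof.
rewrite /zeta_parent has_redE /=; case: eqP => // xyi.
have [i0|i_gt0] := posnP i.
  have -> : i = ord0 by apply: val_inj.
  by rewrite green_ord0 green_vertex0.
have := col_row_lt xy i_gt0 (leq_ord i).
by rewrite -val_green_ord -xyi ltnn.
Qed.

Lemma lv_red j : lv (red_vertex j) = if j == ord0 then 2 else 3.
Proof.
rewrite /= /square_tier /corner /= has_greenE xpair_eqE /= val_red_ord.
case: (eqVneq j ord0) => [->|j0]; first by rewrite (col0 xy).
have j_gt0 : 0 < j by rewrite lt0n.
rewrite (gtn_eqF j_gt0) andbF; case: eqP => // j_eq.
by have := row_col_lt xy j_gt0 (leq_ord j); rewrite -j_eq ltnn.
Qed.

Lemma lv_green i : lv (green_vertex i) = if i == ord0 then 2 else 1.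
Proof.
case: (eqVneq i ord0) => [->|i0]; first by rewrite green_vertex0 lv_red.
rewrite /= /square_tier /corner /= has_greenE xpair_eqE /= val_green_ord eqxx.
by have i_gt0 : 0 < i; rewrite ?lt0n // (gtn_eqF i_gt0).
Qed.

Lemma edge_zeta (s t : vertex (zeta P)) : edge s t =
  (lv s != lv t) && (((val s).1 == (val t).1) || ((val s).2 == (val t).2)).
Proof. by []. Qed.

Lemma zeta_parent_function : parent_function zeta_root zeta_parent zeta_depth.
Proof.
have gr_eq i j : (red_vertex j == green_vertex i) = (i == ord0) && (j == ord0).
  by rewrite eq_sym green_red_vertex_eq.
split=> [||s t].
- by rewrite zeta_parent_red red_ord0 green_vertex0.
- move=> s; case: (vertexP s) => [j|i i0]; rewrite ?red_vertex_eq => s0.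
    rewrite zeta_parent_red /zeta_depth /= ltn_add2l val_green_ord val_red_ord.
    by rewrite (row_col_lt xy) ?leq_ord // lt0n.
  rewrite zeta_parent_green /zeta_depth /= ltn_add2r val_red_ord val_green_ord.
  by rewrite (col_row_lt xy) ?leq_ord // lt0n.
rewrite edge_zeta; case: (vertexP s) => [j|i i0]; case: (vertexP t) => [j'|i' i'0];
  rewrite !(lv_red, lv_green) ?zeta_parent_red ?zeta_parent_green.
- rewrite !red_vertex_eq !green_red_vertex_eq /=.
  case: (eqVneq j ord0) => [->|j0]; case: (eqVneq j' ord0) => [->|j'0] //=;
    rewrite ?red_ord0 ?andbF //.
    by rewrite eq_sym orbF andbT.
  by rewrite (negPf j0) !orbF andbT.
- rewrite !red_vertex_eq green_vertex_eq green_vertex_root (negPf i'0) /=.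
  rewrite (eq_sym (green_ord i')); case: (eqVneq j ord0) => [->|_] //=.
  by rewrite red_ord0 eq_sym (negPf i'0).
- rewrite !red_vertex_eq green_vertex_eq green_vertex_root (negPf i0) /= orbC.
  rewrite (eq_sym i); case: (eqVneq j' ord0) => [->|_] //=.
  by rewrite red_ord0 (eq_sym ord0) (negPf i0).
by rewrite !gr_eq (negPf i0) (negPf i'0) !andbF.
Qed.

Lemma label_red j j' : red_ord j = red_ord j' -> j < j' ->
  wt (red_vertex j) < wt (red_vertex j').
Proof.
move=> eq_x lt_j; have /forallP/(_ (red_ord j, j)) := label_columns P.
move/forallP/(_ (red_ord j', j')).
by rewrite !red_square_labelled /= eq_x eqxx lt_j.
Qed.

Lemma label_green i i' : green_ord i = green_ord i' -> i < i' ->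
  wt (green_vertex i') < wt (green_vertex i).
Proof.
move=> eq_y lt_i; have /forallP/(_ (i, green_ord i)) := label_rows P.
move/forallP/(_ (i', green_ord i')).
by rewrite !green_square_labelled /= eq_y eqxx lt_i.
Qed.

Lemma label_red_parent j : j != ord0 ->
  wt (green_vertex (red_ord j)) < wt (red_vertex j).
Proof.
move=> j0; have /forallP/(_ (val (green_vertex (red_ord j)))) := label_columns P.
move/forallP/(_ (val (red_vertex j))); rewrite !valP /= eqxx val_green_ord val_red_ord.
by rewrite (row_col_lt xy) ?leq_ord // lt0n.
Qed.

Lemma label_green_parent i : i != ord0 ->
  wt (green_vertex i) < wt (red_vertex (green_ord i)).
Proof.
move=> i0; have /forallP/(_ (val (red_vertex (green_ord i)))) := label_rows P.
move/forallP/(_ (val (green_vertex i))); rewrite !valP /= eqxx val_red_ord val_green_ord.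
by rewrite (col_row_lt xy) ?leq_ord // lt0n.
Qed.

Lemma tier1_zeta : tier (zeta P) 1 = green_vertex @: [set~ ord0].
Proof.
apply/setP=> s; rewrite inE; apply/eqP/imsetP => [|[i]]; last first.
  by rewrite !inE => i0 ->; rewrite lv_green (negPf i0).
case: (vertexP s) => [j|i i0 _]; first by rewrite lv_red; case: eqP.
by exists i; rewrite ?inE.
Qed.

Lemma tier2_zeta : tier (zeta P) 2 = [set zeta_root].
Proof.
apply/setP=> s; rewrite !inE; case: (vertexP s) => [j|i i0].
  by rewrite lv_red red_vertex_eq; case: (j == ord0).
by rewrite lv_green green_vertex_root (negPf i0).
Qed.

Lemma tier3_zeta : tier (zeta P) 3 = red_vertex @: [set~ ord0].
Proof.
apply/setP=> s; rewrite inE; apply/eqP/imsetP => [|[j]]; last first.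
  by rewrite !inE => j0 ->; rewrite lv_red (negPf j0).
case: (vertexP s) => [j|i i0]; last by rewrite lv_green (negPf i0).
rewrite lv_red; case: eqP => // /eqP j0 _.
by exists j; rewrite ?inE.
Qed.

Lemma green_vertex_inj : injective green_vertex.
Proof. by move=> i i' /eqP; rewrite green_vertex_eq => /eqP. Qed.

Lemma red_vertex_inj : injective red_vertex.
Proof. by move=> i i' /eqP; rewrite red_vertex_eq => /eqP. Qed.

(** The strict monotonicity along a column separates the labels of red siblings,
    and puts the green parent below its red children; rows do the same for green
    siblings. *)
Lemma zeta_RTT : RTT m n (zeta P).
Proof.
split.
- by rewrite tier1_zeta card_imset ?cardsC1 ?card_ord //; exact: green_vertex_inj.
- by rewrite tier2_zeta cards1.
- by rewrite tier3_zeta card_imset ?cardsC1 ?card_ord //; exact: red_vertex_inj.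
- by move=> s; case: (vertexP s) => [j|i _]; rewrite ?lv_red ?lv_green; case: ifP.
exists zeta_root; first by rewrite tier2_zeta set11.
have parP := zeta_parent_function.
split=> [|s|s t|s t|s t p].
- exact: parent_function_tree parP.
- by have /forallP/(_ (val s))/eqP -> := label_support P; exact: valP s.
- by rewrite edge_zeta => /andP[/eqP].
- suff wt_par u : u != zeta_root ->
      (lv (zeta_parent u) < lv u -> wt (zeta_parent u) < wt u)
      /\ (lv u < lv (zeta_parent u) -> wt u < wt (zeta_parent u)).
    by case: parP => _ _ -> /orP[] /andP[/wt_par[lt gt] /eqP<-].
  case: (vertexP u) => [j|i i0]; rewrite ?red_vertex_eq => u0.
    rewrite zeta_parent_red; split=> [_|]; first exact: label_red_parent.
    by rewrite lv_red (negPf u0) lv_green; case: ifP.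
  rewrite zeta_parent_green; split=> [|_]; last exact: label_green_parent.
  by rewrite lv_green (negPf i0) lv_red; case: ifP.
move=> st /(is_parentP parP)[s0 ->] /(is_parentP parP)[t0].
case: (vertexP s) st s0 => [j|i i0]; case: (vertexP t) t0 => [j'|i' i'0];
  rewrite ?zeta_parent_red ?zeta_parent_green ?lv_red ?lv_green.
- move=> _ /eqP; rewrite red_vertex_eq => jj' _ /green_vertex_inj eq_x _.
  case: (ltngtP j j') => [lt_j|lt_j|/val_inj eq_j].
  + by apply/eqP; rewrite ltn_eqF // label_red.
  + by apply/eqP; rewrite gtn_eqF // label_red.
  by rewrite eq_j eqxx in jj'.
- by rewrite (negPf i'0); case: ifP.
- by rewrite (negPf i0); case: ifP.
move=> _ /eqP; rewrite green_vertex_eq => ii' _ /red_vertex_inj eq_y _.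
case: (ltngtP i i') => [lt_i|lt_i|/val_inj eq_i].
+ by apply/eqP; rewrite gtn_eqF // label_green.
+ by apply/eqP; rewrite ltn_eqF // label_green.
by rewrite eq_i eqxx in ii'.
Qed.

End Zeta.
(** * Injectivity *)

Lemma iso_is_parent (T T' : tiered_graph) (f : vertex T -> vertex T') r i p :
    injective f -> (forall u v, edge (f u) (f v) = edge u v) ->
  is_parent r i p -> is_parent (f r) (f i) (f p).
Proof.
move=> f_inj fE [c [ipc ipc_uniq <-]]; exists (map f c); split.
- by rewrite -map_cons path_map (eq_path (e' := @edge T)).
- by rewrite -!map_cons map_inj_uniq.
by rewrite last_map.
Qed.

Lemma ord_mono_id k (h : 'I_k -> 'I_k) :
  {homo h : i j / (i : nat) < j} -> h =1 id.
Proof.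
have ge_id (g : 'I_k -> 'I_k) : {homo g : i j / (i : nat) < j} -> forall i : 'I_k, i <= g i.
  move=> g_mono [i lt_i]; elim: i lt_i => // i IHi lt_i.
  by apply: leq_ltn_trans (IHi (ltnW lt_i)) _; exact: g_mono.
move=> h_mono i; apply: val_inj; apply/eqP; rewrite eqn_leq (ge_id h h_mono) andbT.
have := ge_id (fun i => rev_ord (h (rev_ord i))) _ (rev_ord i).
rewrite rev_ordK /= leq_sub2lE //; apply=> j j' lt_j /=.
by rewrite ltn_sub2lE // ltnS h_mono //= ltn_sub2lE.
Qed.

Section Injectivity.

Variables (m n : nat) (P Q : LPP m.+1 n.+1).
Variable f : vertex (zeta P) -> vertex (zeta Q).
Hypothesis f_bij : bijective f.
Hypothesis f_edge : forall u v, edge (f u) (f v) = edge u v.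
Hypothesis f_lv : forall u, lv (f u) = lv u.
Hypothesis f_wt : forall u, wt (f u) = wt u.

Let f_inj : injective f := bij_inj f_bij.

Lemma iso_root : f (zeta_root P) = zeta_root Q.
Proof.
apply/set1P; rewrite -tier2_zeta inE f_lv; have := set11 (zeta_root P).
by rewrite -tier2_zeta inE.
Qed.

Lemma iso_parent u : f (zeta_parent u) = zeta_parent (f u).
Proof.
have pP := zeta_parent_function P; have pQ := zeta_parent_function Q.
have [->|ur] := eqVneq u (zeta_root P).
  by case: pP pQ => -> _ _ [+ _ _]; rewrite iso_root => ->.
have := iso_is_parent f_inj f_edge (iffRL (is_parentP pP u _) (conj ur erefl)).
by rewrite iso_root => /(is_parentP pQ)[].
Qed.

Definition red_shift (j : 'I_n.+1) : 'I_n.+1 := (val (f (red_vertex P j))).2.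
Definition green_shift (i : 'I_m.+1) : 'I_m.+1 := (val (f (green_vertex P i))).1.

Lemma iso_red j : f (red_vertex P j) = red_vertex Q (red_shift j).
Proof.
rewrite /red_shift; have := f_lv (red_vertex P j).
case: (vertexP (f _)) => // i i0; rewrite lv_green lv_red (negPf i0).
by case: ifP.
Qed.

Lemma iso_green i : f (green_vertex P i) = green_vertex Q (green_shift i).
Proof.
rewrite /green_shift; have := f_lv (green_vertex P i).
case: (vertexP (f _)) => // j; rewrite lv_green lv_red.
have [-> _|_] := eqVneq j ord0; first by rewrite /= red_ord0 green_vertex0.
by case: ifP.
Qed.

Lemma red_shift_ord j : red_ord Q (red_shift j) = green_shift (red_ord P j).
Proof.
apply: (@green_vertex_inj _ _ Q); rewrite -iso_green -!zeta_parent_red.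
by rewrite iso_parent iso_red.
Qed.

Lemma green_shift_ord i : green_ord Q (green_shift i) = red_shift (green_ord P i).
Proof.
apply: (@red_vertex_inj _ _ Q); rewrite -iso_red -!zeta_parent_green.
by rewrite iso_parent iso_green.
Qed.

Lemma leq_red_ord (L : LPP m.+1 n.+1) (j j' : 'I_n.+1) :
  j <= j' -> red_ord L j <= red_ord L j'.
Proof.
move=> jj'; rewrite !val_red_ord.
by rewrite (col_mono (polyomino_interlaced L)) // -ltnS.
Qed.

Lemma leq_green_ord (L : LPP m.+1 n.+1) (i i' : 'I_m.+1) :
  i <= i' -> green_ord L i <= green_ord L i'.
Proof.
move=> ii'; rewrite !val_green_ord.
by rewrite (row_mono (polyomino_interlaced L)) // -ltnS.
Qed.

(** Induction on the depth of the larger square. For red squares in distinct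
    columns, the columns are those of their green parents, whose order is
    preserved by induction; for red squares of the same column the order is that
    of the labels, which are preserved. Green squares are treated likewise. *)
Lemma shift_mono :
  {homo red_shift : j j' / (j : nat) < j'} /\
  {homo green_shift : i i' / (i : nat) < i'}.
Proof.
suff mono k :
    (forall j j' : 'I_n.+1, zeta_depth (red_vertex P j') < k ->
       j < j' -> red_shift j < red_shift j')
    /\ (forall i i' : 'I_m.+1, zeta_depth (green_vertex P i') < k ->
       i < i' -> green_shift i < green_shift i').
  by split=> [j j'|i i']; [apply: (mono _).1 | apply: (mono _).2].
have [_ ltP _] := zeta_parent_function P.
elim: k => // k [IHred IHgreen]; split=> [j j' lt_k lt_j|i i' lt_k lt_i].
  have j'0 : red_vertex P j' != zeta_root P.
    by rewrite red_vertex_eq -val_eqE -lt0n (leq_ltn_trans _ lt_j).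
  have := leq_red_ord P (ltnW lt_j); rewrite leq_eqVlt => /predU1P[|].
    move/val_inj => eq_x; have := label_red eq_x lt_j.
    rewrite -!f_wt !iso_red ltnNge; apply: contraR; rewrite -leqNgt leq_eqVlt.
    case/predU1P=> [/val_inj->//|lt_j']; apply/ltnW/label_red => //.
    by rewrite !red_shift_ord eq_x.
  have lt_p : zeta_depth (green_vertex P (red_ord P j')) < k.
    by rewrite -zeta_parent_red; exact: leq_trans (ltP _ j'0) lt_k.
  move/(IHgreen _ _ lt_p); rewrite -!red_shift_ord !ltnNge.
  by apply: contraNN; exact: leq_red_ord.
have i'0 : green_vertex P i' != zeta_root P.
  by rewrite green_vertex_root -val_eqE -lt0n (leq_ltn_trans _ lt_i).
have := leq_green_ord P (ltnW lt_i); rewrite leq_eqVlt => /predU1P[|].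
  move/val_inj => eq_y; have := label_green eq_y lt_i.
  rewrite -!f_wt !iso_green ltnNge; apply: contraR; rewrite -leqNgt leq_eqVlt.
  case/predU1P=> [/val_inj->//|lt_i']; apply/ltnW/label_green => //.
  by rewrite !green_shift_ord eq_y.
have lt_p : zeta_depth (red_vertex P (green_ord P i')) < k.
  by rewrite -zeta_parent_green; exact: leq_trans (ltP _ i'0) lt_k.
move/(IHred _ _ lt_p); rewrite -!green_shift_ord !ltnNge.
by apply: contraNN; exact: leq_green_ord.
Qed.

Lemma red_shift_id j : red_shift j = j.
Proof. exact: ord_mono_id shift_mono.1 j. Qed.

Lemma green_shift_id i : green_shift i = i.
Proof. exact: ord_mono_id shift_mono.2 i. Qed.

Lemma iso_red_ord j : red_ord P j = red_ord Q j.
Proof. by rewrite -{2}(red_shift_id j) red_shift_ord green_shift_id. Qed.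

Lemma iso_green_ord i : green_ord P i = green_ord Q i.
Proof. by rewrite -{2}(green_shift_id i) green_shift_ord red_shift_id. Qed.

Lemma iso_pp : pp P = pp Q.
Proof.
apply: polyomino_inj => [j jn|i im].
  have := congr1 val (iso_red_ord (Ordinal (jn : j < n.+1))).
  by rewrite /= !val_red_ord.
have := congr1 val (iso_green_ord (Ordinal (im : i < m.+1))).
by rewrite /= !val_green_ord.
Qed.

Lemma iso_label : label P = label Q.
Proof.
apply/ffunP => s.
have /forallP/(_ s)/eqP supP := label_support P.
have /forallP/(_ s)/eqP supQ := label_support Q.
have [labs|] := boolP (labelled P s); last first.
  move=> nlab; move: supP supQ; rewrite -iso_pp (negPf nlab).
  by case: (label P s) (label Q s) => [|?] [|?].
rewrite -[s]/(val (Sub s labs : vertex (zeta P))).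
case: (vertexP (Sub s labs)) => [j|i _].
  rewrite -[LHS]/(wt (red_vertex P j)) -f_wt iso_red red_shift_id.
  by rewrite /= iso_red_ord.
rewrite -[LHS]/(wt (green_vertex P i)) -f_wt iso_green green_shift_id.
by rewrite /= iso_green_ord.
Qed.

End Injectivity.

Lemma zeta_inj m n (P Q : LPP m.+1 n.+1) : tt_iso (zeta P) (zeta Q) -> P = Q.
Proof.
case=> f [f_bij fE flv fwt].
have := iso_label f_bij fE flv fwt; have := iso_pp f_bij fE flv fwt.
case: P Q {f f_bij fE flv fwt} => [P l lP cP rP] [Q l' lQ cQ rQ] /= eP el.
by subst; congr LabelledPP; exact: eq_irrelevance.
Qed.
(** * Surjectivity *)

(** Row and column conditions on the labels only need to be checked between a
    parent and a child, and between two siblings: in a column all the labelled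
    squares but the lowest are red, with the lowest one as parent, and in a row all
    but the leftmost are green. *)
Lemma interlaced_LPP m n (x y a b : nat -> nat) : interlaced m n x y ->
    a 0 = b 0 -> (forall j, 0 < a j) -> (forall i, 0 < b i) ->
    (forall j, 0 < j <= n -> b (x j) < a j) ->
    (forall i, 0 < i <= m -> b i < a (y i)) ->
    (forall j j', 0 < j < j' -> j' <= n -> x j = x j' -> a j < a j') ->
    (forall i i', 0 < i < i' -> i' <= m -> y i = y i' -> b i' < b i) ->
  exists P : LPP m.+1 n.+1,
    [/\ forall j, red_ord P j = x j :> nat, forall i, green_ord P i = y i :> nat,
        forall j, wt (red_vertex P j) = a j & forall i, wt (green_vertex P i) = b i].
Proof.
move=> xy ab0 a_gt0 b_gt0 lt_ba lt_ab a_mono b_mono.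
have [P0 [P0x P0y]] := interlaced_polyomino xy.
have redP (s : square m.+1 n.+1) : has_red P0 s = (s.1 == x s.2 :> nat).
  by rewrite has_redE P0x ?leq_ord.
have greenP (s : square m.+1 n.+1) : has_green P0 s = (s.2 == y s.1 :> nat).
  by rewrite has_greenE P0y ?leq_ord.
pose lab := [ffun s : square m.+1 n.+1 =>
  if has_red P0 s then a s.2 else if has_green P0 s then b s.1 else 0].
have lab_support : [forall s, (0 < lab s) == labelled P0 s].
  apply/forallP=> s; rewrite ffunE /labelled.
  by case: ifP => _; [|case: ifP => _]; rewrite ?a_gt0 ?b_gt0.
have lab_columns : [forall s, forall t,
    [&& labelled P0 s, labelled P0 t, s.1 == t.1 & s.2 < t.2] ==> (lab s < lab t)].
  apply/forallP=> -[i j]; apply/forallP=> -[i' j']; apply/implyP=> /=.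
  case/and4P=> labs labt /eqP eq_i lt_j; subst i'.
  have jn := leq_ord j; have j'n := leq_ord j'; have im := leq_ord i.
  have j'0 : 0 < j' by apply: leq_ltn_trans lt_j.
  (* Only the lowest labelled square of a column can be green. *)
  have redt : i = x j' :> nat.
    apply/eqP; move: labt; rewrite /labelled redP greenP /= => /orP[//|/eqP def_j'].
    have [i0|i0] := posnP i; first by rewrite def_j' i0 (row0 xy) in j'0.
    have := col_row_lt xy i0 im; rewrite -def_j'.
    move: labs; rewrite /labelled redP greenP /= -def_j' (ltn_eqF lt_j) orbF => /eqP def_i.
    by rewrite ltnNge {1}def_i (col_mono xy) // ltnW.
  rewrite !ffunE !redP greenP /= redt eqxx.
  case: ifP => [/eqP eq_x|neq_x]; last first.
    move: labs; rewrite /labelled redP greenP /= redt neq_x /= => ->.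
    by rewrite lt_ba // j'0.
  have [j0|j0] := posnP j; last by rewrite a_mono ?j0.
  by rewrite j0 ab0 -(col0 xy) -j0 -eq_x lt_ba // j'0.
have lab_rows : [forall s, forall t,
    [&& labelled P0 s, labelled P0 t, s.2 == t.2 & s.1 < t.1] ==> (lab t < lab s)].
  apply/forallP=> -[i j]; apply/forallP=> -[i' j']; apply/implyP=> /=.
  case/and4P=> labs labt /eqP eq_j lt_i; subst j'.
  have im := leq_ord i; have i'm := leq_ord i'; have jn := leq_ord j.
  have i'0 : 0 < i' by apply: leq_ltn_trans lt_i.
  (* Only the leftmost labelled square of a row can be red. *)
  have Nredt : (i' == x j :> nat) = false.
    apply/eqP => def_i'.
    have [j0|j0] := posnP j; first by rewrite def_i' j0 (col0 xy) in i'0.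
    have := row_col_lt xy j0 jn; rewrite -def_i'.
    move: labs; rewrite /labelled redP greenP /= -def_i' (ltn_eqF lt_i) /= => /eqP def_j.
    by rewrite ltnNge {1}def_j (row_mono xy) // ltnW.
  have def_j : j = y i' :> nat.
    by apply/eqP; move: labt; rewrite /labelled redP greenP /= Nredt.
  rewrite !ffunE !redP !greenP /= Nredt -def_j eqxx.
  case: ifP => redNs; first by rewrite def_j lt_ab // i'0.
  move: labs; rewrite /labelled redP greenP /= redNs /= => /[dup] /eqP def_j' ->.
  have i0 : 0 < i.
    rewrite lt0n; apply: contraFneq redNs => i0; rewrite def_j' i0.
    by rewrite (row0 xy) (col0 xy).
  by rewrite b_mono ?i0 // -def_j'.
pose P := LabelledPP lab_support lab_columns lab_rows.
have ordR j : red_ord P j = x j :> nat by rewrite val_red_ord P0x ?leq_ord.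
have ordG i : green_ord P i = y i :> nat by rewrite val_green_ord P0y ?leq_ord.
exists P; split=> // [j|i]; rewrite /= ffunE redP /= ?ordR ?eqxx //.
rewrite greenP /= ordG eqxx; case: eqP => // def_i.
have [i0|i0] := posnP i; first by rewrite i0 (row0 xy).
by have := col_row_lt xy i0 (leq_ord i); rewrite -def_i ltnn.
Qed.

Lemma sorted_enumeration (V : finType) (A : {set V}) (key : V -> nat) (v0 : V) :
    {in A &, injective key} ->
  exists (e : nat -> V) (ix : V -> nat),
    [/\ forall v, v \in A -> ix v < #|A| /\ e (ix v) = v,
        forall j, j < #|A| -> e j \in A /\ ix (e j) = j
      & {in A &, forall u v, (ix u < ix v) = (key u < key v)}].
Proof.
move=> key_inj; pose s := sort (relpre key leq) (enum A).
have mem_s : s =i A by move=> v; rewrite mem_sort mem_enum.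
have s_uniq : uniq s by rewrite sort_uniq enum_uniq.
have s_size : size s = #|A| by rewrite size_sort -cardE.
have s_sorted : sorted (relpre key leq) s.
  by apply: sort_sorted => u v; exact: leq_total.
exists (nth v0 s), (index^~ s); rewrite -s_size; split=> [v|j|u v Au Av].
- by rewrite -mem_s => sv; rewrite index_mem nth_index.
- by move=> lt_j; rewrite -mem_s mem_nth // index_uniq.
have key_index w w' : w \in A -> w' \in A -> index w s <= index w' s -> key w <= key w'.
  rewrite -!mem_s => sw sw'; apply: (sorted_leq_index _ _ s_sorted) => //.
    by move=> ? ? ?; exact: leq_trans.
  by move=> ?; exact: leqnn.
apply/idP/idP => [lt_ix|]; last by rewrite !ltnNge; exact/contraNN/key_index.
rewrite ltn_neqAle key_index ?(ltnW lt_ix) // andbT.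
by apply: contraTneq lt_ix => /key_inj-> //; rewrite ltnn.
Qed.

Lemma RTT_card m n (T : tiered_graph) : RTT m n T -> #|vertex T| = m + 1 + n.
Proof.
case=> card1 card2 card3 lvT _; rewrite -cardsT.
have -> : [set: vertex T] = tier T 1 :|: tier T 2 :|: tier T 3.
  by apply/setP=> v; rewrite !inE -orbA; have := lvT v; rewrite !inE => ->.
rewrite !cardsU.
have disj (A B : {set vertex T}) : [disjoint A & B] -> #|A :&: B| = 0.
  by rewrite -setI_eq0 => /eqP->; rewrite cards0.
by rewrite !disj ?subn0 ?card1 ?card2 ?card3 //; apply/pred0P=> v; rewrite /= !inE;
  case: (lv v) => [|[|[|[|]]]].
Qed.

Section Surjectivity.

Variables (m n : nat) (T : tiered_graph) (r : vertex T).
Variables (par : vertex T -> vertex T) (depth : vertex T -> nat).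
Hypothesis T_RTT : RTT m n T.
Hypothesis r_tier : r \in tier T 2.
Hypothesis rT : tiered_tree r.
Hypothesis parT : parent_function r par depth.

(** The root belongs to both sets: it is the red vertex of row 0 and the green
    vertex of column 0. *)
Definition reds := [set v : vertex T | 1 < lv v].
Definition greens := [set v : vertex T | lv v < 3].

Lemma lv_root v : (lv v == 2) = (v == r).
Proof.
case: T_RTT => _ /eqP/cards1P[r' def_r'] _ _ _.
have:= r_tier; rewrite def_r' => /set1P->.
by have /setP/(_ v) := def_r'; rewrite !inE.
Qed.

Lemma tier_cases v : [\/ v = r, v != r /\ lv v = 1 | v != r /\ lv v = 3].
Proof.
have [->|vr] := eqVneq v r; first by constructor 1.
case: T_RTT => _ _ _ /(_ v) + _; rewrite !inE lv_root (negPf vr) /=.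
by case/orP=> /eqP; [constructor 2 | constructor 3].
Qed.

Lemma root_lv : lv r = 2.
Proof. by apply/eqP; rewrite lv_root. Qed.

Lemma in_reds v : (v \in reds) = (v == r) || (lv v == 3).
Proof.
rewrite inE; case: (tier_cases v) => [->|[/negPf->->]|[/negPf->->]] //.
by rewrite root_lv eqxx.
Qed.

Lemma in_greens v : (v \in greens) = (v == r) || (lv v == 1).
Proof.
rewrite inE; case: (tier_cases v) => [->|[/negPf->->]|[/negPf->->]] //.
by rewrite root_lv eqxx.
Qed.

Lemma card_reds : #|reds| = n.+1.
Proof.
case: T_RTT => _ _ <- _ _; rewrite (cardsD1 r) in_reds eqxx add1n.
congr _.+1; apply: eq_card => v; rewrite inE in_reds !inE.
by case: eqP => // ->; rewrite root_lv.
Qed.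

Lemma card_greens : #|greens| = m.+1.
Proof.
case: T_RTT => <- _ _ _ _; rewrite (cardsD1 r) in_greens eqxx add1n.
congr _.+1; apply: eq_card => v; rewrite inE in_greens !inE.
by case: eqP => // ->; rewrite root_lv.
Qed.

Lemma par_root : par r = r.
Proof. by case: parT. Qed.

Lemma red_par v : v \in reds -> par v \in greens /\ (v != r -> wt (par v) < wt v).
Proof.
have [_ _ lvN wtlt _] := rT.
rewrite in_reds; have [->|vr] := eqVneq v r; first by rewrite par_root in_greens eqxx.
move=> /= /eqP lv3; have := edge_par parT vr => e.
have eS := parent_function_sym parT; rewrite eS in e.
have := lvN _ _ e; rewrite lv3 in_greens => p3.
have lp : par v = r \/ lv (par v) = 1 by case: (tier_cases (par v)) => [|[]|[]]; auto.
split; first by case: lp => ->; rewrite eqxx ?orbT.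
by move=> _; apply: wtlt; rewrite // lv3; case: lp => ->; rewrite ?root_lv.
Qed.

Lemma green_par v : v \in greens -> par v \in reds /\ (v != r -> wt v < wt (par v)).
Proof.
have [_ _ lvN wtlt _] := rT.
rewrite in_greens; have [->|vr] := eqVneq v r; first by rewrite par_root in_reds eqxx.
move=> /= /eqP lv1; have e := edge_par parT vr.
have := lvN _ _ e; rewrite lv1 in_reds => /nesym p1.
have lp : par v = r \/ lv (par v) = 3 by case: (tier_cases (par v)) => [|[]|[]]; auto.
split; first by case: lp => ->; rewrite eqxx ?orbT.
by move=> _; apply: wtlt; rewrite // lv1; case: lp => ->; rewrite ?root_lv.
Qed.

Lemma sibling_wt u v : u != r -> v != r -> par u = par v -> lv u = lv v ->
  wt u = wt v -> u = v.
Proof.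
have [_ _ _ _ sib] := rT; move=> ur vr puv luv wuv; apply/eqP; apply/negPn/negP => /eqP uv.
by apply: (sib u v (par u) uv) wuv => //; apply/(is_parentP parT).
Qed.

(** Write, in base [M] exceeding all labels, the number whose digits are read
    along the path from the root: the label [w] of a vertex of tier 3, and
    [M - w] for a vertex of tier 1. No digit is zero, so deeper vertices get
    larger numbers, and at equal depth the comparison is lexicographic: this is
    the breadth-first order. A vertex is recovered from its tier and its number,
    because the digit tells it apart from its siblings of the same tier. *)
Lemma breadth_first_key : exists key : vertex T -> nat,
  [/\ forall v, v != r -> key (par v) < key v,
      forall u v, u != r -> v != r -> key u <= key v -> key (par u) <= key (par v),
      forall u v, u != r -> v != r -> par u = par v -> lv u = lv v ->
        key u < key v -> if lv u == 3 then wt u < wt v else wt v < wt u,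
      {in reds &, injective key} & {in greens &, injective key}].
Proof.
pose M := (\max_(v : vertex T) wt v).+1.
pose digit (v : vertex T) := if lv v == 3 then wt v else M - wt v.
have [_ wt_gt0 _ _ _] := rT.
have wtM (v : vertex T) : wt v < M by rewrite ltnS leq_bigmax.
have digit_gt0 (v : vertex T) : 0 < digit v.
  by rewrite /digit; case: ifP => // _; rewrite subn_gt0.
have digit_lt v : digit v < M.
  by rewrite /digit; case: ifP => // _; rewrite ltn_subrL wt_gt0.
have [key [key_r keyE]] := par_rec 0 (fun v k => k * M + digit v) parT.
have key_div v : v != r -> key v %/ M = key (par v).
  by move=> vr; rewrite keyE // divnMDl // divn_small ?addn0.
have key_mod v : v != r -> key v %% M = digit v.
  by move=> vr; rewrite keyE // modnMDl modn_small.
have key_par v : v != r -> key (par v) < key v.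
  by move=> vr; rewrite (keyE v vr) -addn1 leq_add // leq_pmulr.
have key_gt0 v : v != r -> 0 < key v.
  by move=> vr; rewrite keyE // addn_gt0 digit_gt0 orbT.
have same_key (u v : vertex T) : lv u = lv v -> digit u = digit v -> wt u = wt v.
  rewrite /digit => ->; case: ifP => // _ eqM.
  by rewrite -(subKn (ltnW (wtM u))) eqM subKn // ltnW.
have inj k : forall u v, key u < k -> key u = key v ->
    (u \in reds) && (v \in reds) || (u \in greens) && (v \in greens) -> u = v.
  elim: k => // k IHk u v lt_k eq_k same.
  have [ur|ur] := eqVneq u r; have [vr|vr] := eqVneq v r.
  - by rewrite ur vr.
  - by have := key_gt0 v vr; rewrite -eq_k ur key_r.
  - by have := key_gt0 u ur; rewrite eq_k vr key_r.
  have eq_lv : lv u = lv v.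
    move: same; rewrite !in_reds !in_greens (negPf ur) (negPf vr) /=.
    by case/orP=> /andP[/eqP-> /eqP->].
  apply: sibling_wt => //.
    apply: IHk; last 1 first.
    - case/orP: same => /andP[].
        by move=> /red_par[-> _] /red_par[-> _]; rewrite orbT.
      by move=> /green_par[-> _] /green_par[-> _].
    - exact: leq_trans (key_par u ur) lt_k.
    by rewrite -!key_div // eq_k.
  by apply: same_key => //; rewrite -!key_mod // eq_k.
exists key; split=> [v vr|u v ur vr le_k|u v ur vr eq_p eq_lv|u v ru rv eq_k|u v gu gv eq_k].
- exact: key_par.
- by rewrite -!key_div // leq_div2r.
- rewrite (keyE u ur) (keyE v vr) eq_p ltn_add2l /digit -eq_lv; case: ifP => // _.
  by rewrite ltn_sub2lE // ltnW.
- by apply: (inj (key u).+1) => //; rewrite ru rv.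
by apply: (inj (key u).+1) => //; rewrite gu gv orbT.
Qed.

(** [R j] and [G i] are the vertices to be placed in row [j] and column [i].
    Since the key increases along the enumerations and parents keep its order,
    the positions [x] and [y] of the parents are increasing; since a grandparent
    has a smaller key, [x (y i) < i]. *)
Lemma bfs_coordinates : exists R G : nat -> vertex T, exists x y : nat -> nat,
  [/\ interlaced m n x y,
      R 0 = r /\ G 0 = r,
      forall j, 0 < j <= n -> [/\ lv (R j) = 3, par (R j) = G (x j) &
        forall j', 0 < j' < j -> x j' = x j -> wt (R j') < wt (R j)],
      forall i, 0 < i <= m -> [/\ lv (G i) = 1, par (G i) = R (y i) &
        forall i', 0 < i' < i -> y i' = y i -> wt (G i) < wt (G i')]
    & (forall j j', j <= n -> j' <= n -> R j = R j' -> j = j') /\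
      (forall i i', i <= m -> i' <= m -> G i = G i' -> i = i')].
Proof.
have [key [key_lt key_mono key_sib red_inj green_inj]] := breadth_first_key.
have [R [ixR [R_ix ixR_R ixR_lt]]] := sorted_enumeration r red_inj.
have [G [ixG [G_ix ixG_G ixG_lt]]] := sorted_enumeration r green_inj.
rewrite card_reds in R_ix ixR_R; rewrite card_greens in G_ix ixG_G.
have r_red : r \in reds by rewrite in_reds eqxx.
have r_green : r \in greens by rewrite in_greens eqxx.
have key_min v : key r <= key v.
  by elim/(par_ind parT): v => // v vr /leq_trans; apply; rewrite ltnW ?key_lt.
have R_mono j j' : j < j' -> j' <= n -> key (R j) < key (R j').
  move=> lt_j j'n; have [Rj ixj] := ixR_R j (ltn_trans lt_j (j'n : j' < n.+1)).
  by have [Rj' ixj'] := ixR_R j' j'n; rewrite -ixR_lt // ixj ixj'.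
have G_mono i i' : i < i' -> i' <= m -> key (G i) < key (G i').
  move=> lt_i i'm; have [Gi ixi] := ixG_G i (ltn_trans lt_i (i'm : i' < m.+1)).
  by have [Gi' ixi'] := ixG_G i' i'm; rewrite -ixG_lt // ixi ixi'.
have R0 : R 0 = r.
  apply: red_inj; rewrite ?(ixR_R 0 isT).1 //; apply/eqP; rewrite eqn_leq key_min andbT.
  by rewrite leqNgt -ixR_lt ?(ixR_R 0 isT).1 // (ixR_R 0 isT).2.
have G0 : G 0 = r.
  apply: green_inj; rewrite ?(ixG_G 0 isT).1 //; apply/eqP; rewrite eqn_leq key_min andbT.
  by rewrite leqNgt -ixG_lt ?(ixG_G 0 isT).1 // (ixG_G 0 isT).2.
have ixR_r : ixR r = 0 by rewrite -R0 (ixR_R 0 isT).2.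
have ixG_r : ixG r = 0 by rewrite -G0 (ixG_G 0 isT).2.
have R_neq0 j : 0 < j -> j <= n -> R j != r.
  by move=> j0 jn; apply: contraTneq j0 => eq_j; rewrite -(ixR_R j jn).2 eq_j ixR_r.
have G_neq0 i : 0 < i -> i <= m -> G i != r.
  by move=> i0 im; apply: contraTneq i0 => eq_i; rewrite -(ixG_G i im).2 eq_i ixG_r.
have ixR_mono u v : u \in reds -> v \in reds -> key u <= key v -> ixR u <= ixR v.
  by move=> ru rv le_k; rewrite leqNgt ixR_lt // -leqNgt.
have ixG_mono u v : u \in greens -> v \in greens -> key u <= key v -> ixG u <= ixG v.
  by move=> gu gv le_k; rewrite leqNgt ixG_lt // -leqNgt.
have R_lv j : 0 < j -> j <= n -> lv (R j) = 3.
  move=> j0 jn; have := (ixR_R j jn).1.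
  by rewrite in_reds (negPf (R_neq0 j j0 jn)) => /eqP.
have G_lv i : 0 < i -> i <= m -> lv (G i) = 1.
  move=> i0 im; have := (ixG_G i im).1.
  by rewrite in_greens (negPf (G_neq0 i i0 im)) => /eqP.
have parR j : j <= n -> par (R j) \in greens.
  by move=> jn; case: (red_par (ixR_R j jn).1).
have parG i : i <= m -> par (G i) \in reds.
  by move=> im; case: (green_par (ixG_G i im).1).
pose x j := ixG (par (R j)); pose y i := ixR (par (G i)).
have Gx j : j <= n -> G (x j) = par (R j) by move=> /parR/G_ix[].
have Ry i : i <= m -> R (y i) = par (G i) by move=> /parG/R_ix[].
exists R, G, x, y; split=> //; last first.
- split=> [j j' jn j'n eqR|i i' im i'm eqG].
    by rewrite -(ixR_R j jn).2 eqR (ixR_R j' j'n).2.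
  by rewrite -(ixG_G i im).2 eqG (ixG_G i' i'm).2.
- move=> i /andP[i0 im]; split; [exact: G_lv|by rewrite Ry|].
  move=> i' /andP[i'0 lt_i] eq_y; have i'm := leq_trans (ltnW lt_i) im.
  have := key_sib (G i') (G i) (G_neq0 _ i'0 i'm) (G_neq0 _ i0 im).
  by rewrite -!Ry // eq_y !G_lv //=; apply=> //; apply: G_mono.
- move=> j /andP[j0 jn]; split; [exact: R_lv|by rewrite Gx|].
  move=> j' /andP[j'0 lt_j] eq_x; have j'n := leq_trans (ltnW lt_j) jn.
  have := key_sib (R j') (R j) (R_neq0 _ j'0 j'n) (R_neq0 _ j0 jn).
  by rewrite -!Gx // eq_x !R_lv //=; apply=> //; apply: R_mono.
split.
- by rewrite /x R0 par_root.
- by rewrite /y G0 par_root.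
- by move=> j /parR/G_ix[].
- by move=> i /parG/R_ix[].
- move=> j j' le_j j'n; have [->|j0] := posnP j; first by rewrite /x R0 par_root ixG_r.
  have jn := leq_trans le_j j'n; have j'0 := leq_trans j0 le_j.
  apply: ixG_mono; rewrite ?parR //; apply: key_mono; rewrite ?R_neq0 //.
  by move: le_j; rewrite leq_eqVlt => /predU1P[->//|lt_j]; exact/ltnW/R_mono.
- move=> i i' le_i i'm; have [->|i0] := posnP i; first by rewrite /y G0 par_root ixR_r.
  have im := leq_trans le_i i'm; have i'0 := leq_trans i0 le_i.
  apply: ixR_mono; rewrite ?parG //; apply: key_mono; rewrite ?G_neq0 //.
  by move: le_i; rewrite leq_eqVlt => /predU1P[->//|lt_i]; exact/ltnW/G_mono.
move=> i i0 im; rewrite -{2}(ixG_G i im).2 /x Ry // ixG_lt; last first.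
- by case: (ixG_G i im).
- by case: (red_par (parG i im)).
have Gi := G_neq0 i i0 im; have := key_lt _ Gi.
have [->|pr] := eqVneq (par (G i)) r; first by rewrite par_root.
by apply: ltn_trans; exact: key_lt.
Qed.

Lemma exists_zeta_iso : exists P : LPP m.+1 n.+1, tt_iso (zeta P) T.
Proof.
have [R [G [x [y [xy [R0 G0] RP GP [R_inj G_inj]]]]]] := bfs_coordinates.
have [_ wt_gt0 _ _ _] := rT.
have [|||||||P [ordR ordG wtR wtG]] :=
    @interlaced_LPP m n x y (fun j => wt (R j)) (fun i => wt (G i)) xy.
- by rewrite R0 G0.
- by move=> j; exact: wt_gt0.
- by move=> i; exact: wt_gt0.
- move=> j /andP[j0 jn]; have [lvR <- _] := RP j (introT andP (conj j0 jn)).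
  case: (@red_par (R j)) => [|_]; first by rewrite in_reds lvR eqxx orbT.
  by apply; rewrite -lv_root lvR.
- move=> i /andP[i0 im]; have [lvG <- _] := GP i (introT andP (conj i0 im)).
  case: (@green_par (G i)) => [|_]; first by rewrite in_greens lvG eqxx orbT.
  by apply; rewrite -lv_root lvG.
- move=> j j' /andP[j0 lt_j] j'n eq_x; have [|_ _] := RP j'.
    by rewrite (ltn_trans j0 lt_j).
  by apply=> //; rewrite j0.
- move=> i i' /andP[i0 lt_i] i'm eq_y; have [|_ _] := GP i'.
    by rewrite (ltn_trans i0 lt_i).
  by apply=> //; rewrite i0.
pose f (v : vertex (zeta P)) := if has_red P (val v) then R (val v).2 else G (val v).1.
have f_red j : f (red_vertex P j) = R j.
  by rewrite /f has_redE /= val_red_ord eqxx.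
have f_green i : f (green_vertex P i) = G i.
  rewrite /f has_redE /= -val_red_ord ordR ordG; case: eqP => // def_i.
  have [i0|i0] := posnP i; first by rewrite i0 (row0 xy) R0 G0.
  by have := col_row_lt xy i0 (leq_ord i); rewrite -def_i ltnn.
have f_root : f (zeta_root P) = r by rewrite f_red.
have f_lv v : lv (f v) = lv v.
  case: (vertexP v) => [j|i i0]; rewrite ?f_red ?f_green ?lv_red ?lv_green.
    have [->|j0] := eqVneq j ord0; first by rewrite R0 root_lv.
    by have [|->] := RP j; rewrite // lt0n j0 leq_ord.
  rewrite (negPf i0); have [|->] := GP i; rewrite // lt0n i0 leq_ord //.
have f_par v : f (zeta_parent v) = par (f v).
  case: (vertexP v) => [j|i i0].
    rewrite zeta_parent_red f_green f_red ordR.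
    have [->|j0] := posnP j; first by rewrite R0 (col0 xy) G0 par_root.
    by have [|_ ->] := RP j; rewrite // j0 leq_ord.
  rewrite zeta_parent_green f_green f_red ordG.
  by have [|_ ->] := GP i; rewrite // lt0n i0 leq_ord.
have f_inj : injective f.
  move=> u v; have [eq_lv|] := eqVneq (lv u) (lv v); last first.
    by rewrite -!f_lv => + eq_f; rewrite eq_f eqxx.
  move: eq_lv; case: (vertexP u) => [j|i i0]; case: (vertexP v) => [j'|i' i'0];
    rewrite ?lv_red ?lv_green ?(negPf i0) ?(negPf i'0) ?f_red ?f_green.
  - by move=> _ /R_inj eq_j; congr red_vertex; apply/val_inj/eq_j; exact: leq_ord.
  - by case: ifP.
  - by case: ifP.
  by move=> _ /G_inj eq_i; congr green_vertex; apply/val_inj/eq_i; exact: leq_ord.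
exists P, f; split=> // [|u v|v].
(* Both vertex sets have [m + 1 + n] elements. *)
- by apply: inj_card_bij f_inj _; rewrite (RTT_card T_RTT) (RTT_card (zeta_RTT P)).
- have [_ _ eP] := zeta_parent_function P; have [_ _ eT] := parT.
  by rewrite eP eT -f_root -!f_par !(inj_eq f_inj).
by case: (vertexP v) => [j|i _]; rewrite ?f_red ?f_green ?wtR ?wtG.
Qed.

End Surjectivity.

Lemma zeta_surj m n (T : tiered_graph) :
  RTT m n T -> exists P : LPP m.+1 n.+1, tt_iso (zeta P) T.
Proof.
move=> T_RTT; have [_ _ _ _ [r r_tier rT]] := T_RTT.
have [T_tree _ _ _ _] := rT.
have [par [depth parT]] := tree_parent_function r T_tree.
exact: exists_zeta_iso T_RTT r_tier rT parT.
Qed.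

(* zeta maps into RTT(m,1,n), and is injective and surjective onto RTT(m,1,n)
   modulo isomorphism. *)
Theorem proposition7p4 (m n : nat) :
  [/\ forall P : LPP m.+1 n.+1, RTT m n (zeta P),
      forall P Q : LPP m.+1 n.+1, tt_iso (zeta P) (zeta Q) -> P = Q
    & forall T : tiered_graph, RTT m n T ->
        exists P : LPP m.+1 n.+1, tt_iso (zeta P) T].
Proof.
split; [exact: zeta_RTT | exact: zeta_inj | exact: zeta_surj].
Qed.
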